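(* Let $\mathcal{H}$ be an infinite-dimensional separable Hilbert space and let $(f_n)$ and $(g_n)$ be sequences in $\mathcal{H}$. Define the operator $M$ by $Mf=\sum_n\langle f,g_n\rangle f_n$, with domain consisting of those $f\in\mathcal{H}$ for which this series converges in $\mathcal{H}$. If $M$ is closed and its range is $R(M)=\mathcal{H}$, then for every $A\in(0,\infty)$ there exists $(\omega_n)\subset(0,\infty)$ such that $(\omega_nf_n)$ is a lower semi frame for $\mathcal{H}$ with bound $A$.
   Context: All sequences are indexed by $\mathbb{N}$. A sequence $(h_n)$ in $\mathcal{H}$ is a lower semi frame for $\mathcal{H}$ with bound $A>0$ if $A\|f\|^2\le\sum_n|\langle f,h_n\rangle|^2$ for all $f\in\mathcal{H}$ (the sum may be $+\infty$). *)

(* Defs.v *)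
From HB Require Import structures.
From mathcomp Require Import all_boot all_order all_algebra.
From mathcomp Require Import sesquilinear complex.
From mathcomp Require Import all_classical all_reals all_analysis.

Set Implicit Arguments.
Unset Strict Implicit.
Unset Printing Implicit Defensive.

Import Order.TTheory GRing.Theory Num.Theory.
Import numFieldNormedType.Exports.

Local Open Scope classical_set_scope.
Local Open Scope ring_scope.
Local Open Scope complex_scope.

(* Hilbert spaces are taken over the reals or over the complex numbers. *)
Variant scalar_kind := RealScalars | ComplexScalars.

Definition scalar_field (R : realType) (k : scalar_kind) : numFieldType :=
  match k with
  | RealScalars => R
  | ComplexScalars => R[i]
  end.

Definition conj_scalar (R : realType) (k : scalar_kind) :
    scalar_field R k -> scalar_field R k :=
  match k return scalar_field R k -> scalar_field R k with
  | RealScalars => idfun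
  | ComplexScalars => @conjc R
  end.

Definition of_real (R : realType) (k : scalar_kind) : R -> scalar_field R k :=
  match k return R -> scalar_field R k with
  | RealScalars => idfun
  | ComplexScalars => real_complex R
  end.

Definition re_scalar (R : realType) (k : scalar_kind) : scalar_field R k -> R :=
  match k return scalar_field R k -> R with
  | RealScalars => idfun
  | ComplexScalars => @complex.Re R
  end.

(* Norms over a numFieldType K take their values in K; these are the same
   (nonnegative real) numbers seen in R. *)
Definition rmod (R : realType) (k : scalar_kind) (z : scalar_field R k) : R :=
  re_scalar `|z|.

Definition rnorm (R : realType) (k : scalar_kind)
    (H : normedModType (scalar_field R k)) (x : H) : R :=
  re_scalar `|x|.

(* The form is linear in its first argument, conjugate-linear in the second. *)
Definition induces_norm (R : realType) (k : scalar_kind)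
    (H : normedModType (scalar_field R k)) (dot : {dot H for @conj_scalar R k}) : Prop :=
  forall x : H, `|x| ^+ 2 = dot x x.

Definition finite_dimensional (K : numFieldType) (V : lmodType K) : Prop :=
  exists (n : nat) (e : 'I_n -> V),
    forall x : V, exists c : 'I_n -> K, x = \sum_(i < n) c i *: e i.

Definition separable_space (T : topologicalType) : Prop :=
  exists2 D : set T, countable D & dense D.

Definition closed_operator (K : numFieldType) (V W : normedModType K)
    (D : set V) (T : V -> W) : Prop :=
  closed [set p : V * W | D p.1 /\ p.2 = T p.1].

Section Multiplier.
Variables (R : realType) (k : scalar_kind) (H : normedModType (scalar_field R k)).
Variables (dot : {dot H for @conj_scalar R k}) (f_ g_ : nat -> H).

Definition mult_series (f : H) : nat -> H :=
  series (fun n => dot f (g_ n) *: f_ n).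

Definition mult_dom : set H := [set f | cvg (mult_series f @ \oo)].

(* Only meaningful on [mult_dom]. *)
Definition mult_op (f : H) : H := lim (mult_series f @ \oo).

End Multiplier.

Definition lower_semi_frame (R : realType) (k : scalar_kind)
    (H : normedModType (scalar_field R k)) (dot : {dot H for @conj_scalar R k})
    (h : nat -> H) (A : R) : Prop :=
  0 < A /\
  forall f : H,
    ((A * rnorm f ^+ 2)%:E <=
       \sum_(0 <= n <oo) (rmod (dot f (h n)) ^+ 2)%:E)%E.

(* Main.v *)
(** With [w_n = (|g_n| + 1) 2^n], let [B] be the set of all [h] with
    [w_n |<f_n, h>| <= 1] for every [n].  If [y = M f], then
    [|<y, h>| <= sum_n |f| |g_n| |<f_n, h>| <= 2 |f|] for [h] in [B]; since [M]
    is onto, [B] is weakly bounded, hence bounded in norm by some [C].  By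
    homogeneity [|h| <= C sup_n w_n |<h, f_n>|], so the weights
    [C sqrt(A) w_n] (with [C > 0]) work: already the supremum of the terms of
    the frame sum is at least [A |h|^2]. *)
Require Import Defs.
From HB Require Import structures.
From mathcomp Require Import all_boot all_order all_algebra.
From mathcomp Require Import sesquilinear complex.
From mathcomp Require Import all_classical all_reals all_analysis.
From mathcomp Require Import ring lra.
Set Implicit Arguments.
Unset Strict Implicit.
Unset Printing Implicit Defensive.

Import Order.TTheory GRing.Theory Num.Theory.
Import numFieldNormedType.Exports.
Local Open Scope classical_set_scope.
Local Open Scope ring_scope.

(** * Scalars, moduli and norms as real numbers, over both fields at once *)

Section Scalars.
Variables (R : realType) (k : scalar_kind).
Local Notation K := (scalar_field R k).

Lemma of_realD (a b : R) : of_real k (a + b) = of_real k a + of_real k b.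
Proof. by case: k => //=; rewrite rmorphD. Qed.

Lemma of_realN (a : R) : of_real k (- a) = - of_real k a.
Proof. by case: k => //=; rewrite rmorphN. Qed.

Lemma of_realM (a b : R) : of_real k (a * b) = of_real k a * of_real k b.
Proof. by case: k => //=; rewrite rmorphM. Qed.

Lemma of_real0 : of_real k 0 = 0 :> K.
Proof. by case: k. Qed.

Lemma of_real1 : of_real k 1 = 1 :> K.
Proof. by case: k. Qed.

Lemma of_real_inj : injective (@of_real R k).
Proof. by case: k => // a b []. Qed.

Lemma ler_of_real (a b : R) : (of_real k a <= of_real k b) = (a <= b).
Proof. by case: k => //=; rewrite lecR. Qed.

Lemma ltr_of_real (a b : R) : (of_real k a < of_real k b) = (a < b).
Proof. by case: k => //=; rewrite ltcR. Qed.

(** The order of [R[i]] compares only numbers with equal imaginary parts, so [0 <= z] already forces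
    [z] to be real. *)
Lemma re_scalarK (z : K) : 0 <= z -> of_real k (re_scalar z) = z.
Proof.
case: k z => //= z z0; apply: RRe_real; exact: ger0_real.
Qed.

Lemma of_real_rmod (z : K) : of_real k (rmod z) = `|z|.
Proof. exact: re_scalarK. Qed.

Lemma norm_of_real (a : R) : `|of_real k a| = of_real k `|a|.
Proof. by case: k => //=; rewrite normc_def /= expr0n addr0 sqrtr_sqr. Qed.

Lemma conj_of_real (a : R) : conj_scalar (of_real k a) = of_real k a.
Proof. by case: k => //=; rewrite oppr0. Qed.

Lemma normK_conj (z : K) : z * conj_scalar z = `|z| ^+ 2.
Proof.
case: k z => /= z; last by rewrite sqr_normc.
by rewrite real_normK ?num_real// expr2.
Qed.

Lemma norm_conj (z : K) : `|conj_scalar z| = `|z|.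
Proof. by case: k z => //= z; rewrite normcJ. Qed.

Lemma rmod_ge0 (z : K) : 0 <= rmod z.
Proof. by rewrite -ler_of_real of_real0 of_real_rmod. Qed.

Lemma rmodM (z w : K) : rmod (z * w) = rmod z * rmod w.
Proof. by apply: of_real_inj; rewrite of_realM !of_real_rmod normrM. Qed.

Lemma rmodD (z w : K) : rmod (z + w) <= rmod z + rmod w.
Proof. by rewrite -ler_of_real of_realD !of_real_rmod ler_normD. Qed.

Lemma rmodN (z : K) : rmod (- z) = rmod z.
Proof. by apply: of_real_inj; rewrite !of_real_rmod normrN. Qed.

Lemma rmod_of_real (a : R) : rmod (of_real k a) = `|a|.
Proof. by apply: of_real_inj; rewrite of_real_rmod norm_of_real. Qed.

Lemma rmod_sum n (F : nat -> K) :
  rmod (\sum_(0 <= i < n) F i) <= \sum_(0 <= i < n) rmod (F i).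
Proof.
elim: n => [|n IH]; first by rewrite !big_nil -of_real0 rmod_of_real normr0.
by rewrite !big_nat_recr//=; apply: le_trans (rmodD _ _) _; rewrite lerD2r.
Qed.

Variable H : normedModType K.

Lemma of_real_rnorm (x : H) : of_real k (rnorm x) = `|x|.
Proof. exact: re_scalarK. Qed.

Lemma rnorm_ge0 (x : H) : 0 <= rnorm x.
Proof. by rewrite -ler_of_real of_real0 of_real_rnorm. Qed.

Lemma rnorm_eq0 (x : H) : (rnorm x == 0) = (x == 0).
Proof.
by rewrite -(inj_eq of_real_inj) of_real_rnorm of_real0 normr_eq0.
Qed.

Lemma rnorm0 : rnorm (0 : H) = 0.
Proof. by apply/eqP; rewrite rnorm_eq0. Qed.

Lemma rnormD (x y : H) : rnorm (x + y) <= rnorm x + rnorm y.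
Proof. by rewrite -ler_of_real of_realD !of_real_rnorm ler_normD. Qed.

Lemma rdistC (x y : H) : rnorm (x - y) = rnorm (y - x).
Proof. by apply: of_real_inj; rewrite !of_real_rnorm distrC. Qed.

Lemma rnormZ (a : K) (x : H) : rnorm (a *: x) = rmod a * rnorm x.
Proof.
by apply: of_real_inj; rewrite of_realM of_real_rmod !of_real_rnorm normrZ.
Qed.

Lemma cvg_rnormP (u : nat -> H) (l : H) :
  u @ \oo --> l ->
  forall e : R, 0 < e -> exists N, forall n, (N <= n)%N -> rnorm (l - u n) < e.
Proof.
move=> /cvgrPdist_lt ul e e0.
have [|N _ HN] := ul (of_real k e); first by rewrite -of_real0 ltr_of_real.
exists N => n Nn; rewrite -ltr_of_real of_real_rnorm; exact: (HN n).
Qed.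

End Scalars.

(** A positive scalar is the image of a positive real, so real radii suffice for the filter form of
    the Cauchy property; [u N] serves as the centre of the ball. *)
Lemma rnorm_cauchy_cvg (R : realType) (k : scalar_kind)
    (H : completeNormedModType (scalar_field R k)) (u : nat -> H) :
  (forall e : R, 0 < e ->
    exists N, forall n, (N <= n)%N -> rnorm (u N - u n) < e) ->
  cvg (u @ \oo).
Proof.
move=> uC; apply: cauchy_cvg; apply: cauchy_exP => e e0.
have eE := re_scalarK (ltW e0).
have [|N HN] := uC (re_scalar e); first by rewrite -(ltr_of_real k) eE of_real0.
exists (u N); exists N => // n Nn.
rewrite -ball_normE /ball_ /= -eE -of_real_rnorm ltr_of_real; exact: HN.
Qed.

(** * Sesquilinear algebra and the Cauchy-Schwarz inequality *)

Section Inner.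
Variables (R : realType) (k : scalar_kind).
Variable (H : normedModType (scalar_field R k)).
Variable (dot : {dot H for @conj_scalar R k}).


Lemma dotC x y : dot x y = conj_scalar (dot y x).
Proof. by rewrite (hermitian_subproof (s := dot)) expr0 mul1r. Qed.

Lemma dotZl a x y : dot (a *: x) y = a * dot x y.
Proof. by rewrite linearZl_LR. Qed.

Lemma dotZr a x y : dot x (a *: y) = conj_scalar a * dot x y.
Proof. by rewrite linearZr_LR. Qed.

Lemma dotDl x y z : dot (x + y) z = dot x z + dot y z.
Proof. by rewrite linearDl. Qed.

Lemma dotBl x y z : dot (x - y) z = dot x z - dot y z.
Proof. by rewrite linearBl. Qed.

Lemma dotBr x y z : dot x (y - z) = dot x y - dot x z.
Proof. by rewrite linearBr. Qed.

Lemma rmod_dotC x y : rmod (dot x y) = rmod (dot y x).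
Proof. by apply: (@of_real_inj R k); rewrite !of_real_rmod dotC norm_conj. Qed.

Hypothesis dot_norm : induces_norm dot.

Lemma dotxx x : dot x x = of_real k (rnorm x ^+ 2).
Proof. by rewrite -dot_norm expr2 of_realM of_real_rnorm -expr2. Qed.

(** For nonzero [y], put [d = |y|^2] and [b = <x, y>]: the squared norm of [d x - b y] equals
    [d (d |x|^2 - |b|^2)], and [d > 0] can be cancelled. Scaling [x] by [d] avoids a division. *)
Lemma cauchy_schwarz (x y : H) : rmod (dot x y) <= rnorm x * rnorm y.
Proof.
have [->|y0] := eqVneq y 0.
  by rewrite linear0r -(of_real0 R k) rmod_of_real normr0 mulr_ge0 ?rnorm_ge0.
have ry0 : 0 < rnorm y by rewrite lt_def rnorm_eq0 y0 rnorm_ge0.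
set d := dot y y; set b := dot x y.
have dE : d = of_real k (rnorm y ^+ 2) by rewrite /d dotxx.
have dJ : conj_scalar d = d by rewrite dE conj_of_real.
have bJ : dot y x = conj_scalar b by rewrite dotC.
have wE : dot (d *: x - b *: y) (d *: x - b *: y) =
    d * (d * dot x x - b * conj_scalar b).
  rewrite dotBl !dotBr !dotZl !dotZr dJ bJ -/d -/b.
  ring.
have : 0 <= rnorm y ^+ 2 * (rnorm y ^+ 2 * rnorm x ^+ 2 - rmod b ^+ 2).
  have -> : rnorm y ^+ 2 * (rnorm y ^+ 2 * rnorm x ^+ 2 - rmod b ^+ 2) =
      rnorm (d *: x - b *: y) ^+ 2.
    apply: (@of_real_inj R k); rewrite -dotxx wE normK_conj dE dotxx.
    rewrite of_realM of_realD of_realN of_realM; congr (_ * (_ - _)).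
    by rewrite [rmod b ^+ 2]expr2 of_realM of_real_rmod -expr2.
  exact: sqr_ge0.
rewrite pmulr_rge0 ?exprn_gt0// subr_ge0 -exprMn => h.
rewrite -(ler_pXn2r (ltn0Sn 1)) ?nnegrE ?rmod_ge0 ?mulr_ge0 ?rnorm_ge0//.
by rewrite [leRHS]exprMn mulrC -exprMn.
Qed.

End Inner.

(** * Uniform boundedness in a Hilbert space *)

Section Completeness.
Variables (R : realType) (k : scalar_kind).
Variable (H : completeNormedModType (scalar_field R k)).
Variable (dot : {dot H for @conj_scalar R k}).
Hypothesis dot_norm : induces_norm dot.

(** Replacing [l] by a late [u m] costs at most [e] in the triangle inequality, and [e] is
    arbitrary. *)
Lemma rdist_lim_le (u : nat -> H) (l : H) (N : nat) (c : R) :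
  u @ \oo --> l -> (forall m, (N <= m)%N -> rnorm (u m - u N) <= c) ->
  rnorm (l - u N) <= c.
Proof.
move=> ul uc; apply/ler_addgt0Pr => e e0.
have [M HM] := cvg_rnormP ul e0; pose m := maxn M N.
have -> : l - u N = (l - u m) + (u m - u N) by rewrite addrA subrK.
rewrite addrC; apply: le_trans (rnormD _ _) _.
by rewrite lerD// ?uc ?leq_maxr// ltW// HM// leq_maxl.
Qed.

(* Moving [x] by [v] or by [- v], where [v] is the multiple of [h] of norm [r],
   makes the pairing with [h] at least [r |h|]. *)
Lemma exists_large_dot (x h : H) (r : R) : 0 < r -> 0 < rnorm h ->
  exists z, rnorm (z - x) <= r /\ r * rnorm h <= rmod (dot z h).
Proof.
move=> r0 h0; pose v := of_real k (r / rnorm h) *: h.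
have vr : rnorm v = r.
  by rewrite rnormZ rmod_of_real ger0_norm ?divr_ge0 ?ltW// divfK// gt_eqF.
have vh : rmod (dot v h) = r * rnorm h.
  rewrite dotZl (dotxx dot_norm) -of_realM rmod_of_real expr2 mulrA.
  by rewrite divfK ?gt_eqF// ger0_norm// mulr_ge0 ?ltW.
have [?|lt1] := leP (r * rnorm h) (rmod (dot (x - v) h)).
  by exists (x - v); split; rewrite // addrAC subrr rdistC subr0 vr.
exists (x + v); split; first by rewrite addrAC subrr add0r vr.
(* The two candidates differ by [2 v], whose pairing with [h] has modulus [2 r |h|]; if one falls
   short of half of this, the other reaches it. *)
have : rmod (dot (v + v) h) <= rmod (dot (x + v) h) + rmod (dot (x - v) h).
  rewrite -[rmod (dot (x - v) h)]rmodN; apply: le_trans (rmodD _ _).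
  by rewrite -dotBl opprB [x + v]addrC addrACA subrr addr0.
have -> : dot (v + v) h = of_real k 2 * dot v h.
  by rewrite -dotZl -[2]/(1 + 1) of_realD of_real1 scalerDl scale1r.
by rewrite rmodM rmod_of_real vh ger0_norm//; lra.
Qed.

(* Gliding hump ([Banach_Steinhauss] covers real scalars only): the n-th step
   has length at most [3^-n] and makes the pairing with [h n] at least
   [3^-n |h n| > n]; the later steps add up to at most half of [3^-n], hence
   cannot undo more than half of it. *)
Lemma weakly_bounded_bounded (B : set H) :
  (forall x, exists c : R, forall h, B h -> rmod (dot x h) <= c) ->
  exists C : R, forall h, B h -> rnorm h <= C.
Proof.
move=> wB; apply: contrapT => nB.
(* The factor [3 ^+ n] compensates the step length [3 ^- n], so that the pairing gained at step [n]
   exceeds [n]. *)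
have hB n : exists h, B h /\ n%:R * 3 ^+ n < rnorm h.
  apply: contrapT => nh; apply: nB; exists (n%:R * 3 ^+ n) => h Bh.
  by rewrite leNgt; apply/negP => lt; apply: nh; exists h.
have [h hP] := choice hB.
have r0 n : 0 < 3 ^- n :> R by rewrite invr_gt0 exprn_gt0.
have h0 n : 0 < rnorm (h n).
  by apply: le_lt_trans (hP n).2; rewrite mulr_ge0 ?exprn_ge0.
have [f fP] := choice (fun p : H * nat =>
  exists_large_dot p.1 (r0 p.2) (h0 p.2)).
pose x := fix x n := if n is p.+1 then f (x p, p) else 0.
(* The bound is the exact geometric sum of [3 ^- j] over [n <= j < n + p]; without the subtracted
   term the induction on [p] would not close. *)
have dist n p : rnorm (x (n + p)%N - x n) <= 3 / 2 * (3 ^- n - 3 ^- (n + p)%N).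
  elim: p => [|p IH].
    by rewrite addn0 !subrr mulr0 -(@rnorm0 R k H).
  have := (fP (x (n + p)%N, (n + p)%N)).1; rewrite /= -/(x (n + p).+1) addnS.
  have -> : x (n + p).+1 - x n =
    (x (n + p).+1 - x (n + p)%N) + (x (n + p)%N - x n) by rewrite addrA subrK.
  have := rnormD (x (n + p).+1 - x (n + p)%N) (x (n + p)%N - x n).
  have -> : 3 ^- (n + p).+1 = 3 ^- (n + p)%N / 3 :> R.
    by rewrite exprSr invfM mulrC.
  lra.
have distle n m : (n <= m)%N -> rnorm (x m - x n) <= 3 / 2 * 3 ^- n.
  move=> nm; have := dist n (m - n)%N; rewrite subnKC// => d.
  by apply: le_trans d _; have := r0 m; lra.
have /cvg_ex[l xl] : cvg (x @ \oo).
  (* This choice gives [3 ^ N.+1 > N.+1 > 3 / (2 e)], so the tail bound at [N.+1] is below [e]. *)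
  apply: rnorm_cauchy_cvg => e e0; pose N := (Num.truncn (3 / 2 / e)).
  exists N.+1 => n Nn; rewrite rdistC; apply: le_lt_trans (distle _ _ Nn) _.
  rewrite ltr_pdivrMr ?exprn_gt0// [ltRHS]mulrC -ltr_pdivrMr//.
  apply: lt_le_trans (truncnS_gt _) _.
  apply: (@le_trans _ _ (3 ^ N.+1)%:R); last by rewrite natrX.
  by rewrite ler_nat ltnW// ltn_expl.
have xlN n : rnorm (l - x n) <= 3 / 2 * 3 ^- n.
  by apply: rdist_lim_le => // m; exact: distle.
have [c cP] := wB l.
(* The pairing of [l] with [h n] keeps at least half of [3 ^- n |h n| > n], so any [n > 2 c]
   contradicts the bound [c]. *)
pose n := (Num.truncn (2 * c)).+1.
have c_lt : 2 * c < n%:R by exact: truncnS_gt.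
have := (fP (x n, n)).2; rewrite /= -/(x n.+1) => big.
(* The tail after [x n.+1] is at most [3 / 2] times [3 ^- n.+1], which is half of [3 ^- n]. *)
have near_l : rmod (dot (x n.+1 - l) (h n)) <= 3 ^- n / 2 * rnorm (h n).
  apply: le_trans (cauchy_schwarz dot_norm _ _) _.
  rewrite ler_pM2r// rdistC; apply: le_trans (xlN _) _.
  by rewrite exprSr invfM; lra.
have split_x : rmod (dot (x n.+1) (h n)) <=
    rmod (dot (x n.+1 - l) (h n)) + rmod (dot l (h n)).
  by apply: le_trans (rmodD _ _); rewrite -dotDl subrK.
have := cP _ (hP n).1.
have : n%:R < 3 ^- n * rnorm (h n).
  by rewrite mulrC ltr_pdivlMr ?exprn_gt0//; exact: (hP n).2.
lra.
Qed.

End Completeness.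

(** * Estimates for the multiplier series *)

Section Multipliers.
Variables (R : realType) (k : scalar_kind).
Variable (H : normedModType (scalar_field R k)).
Variable (dot : {dot H for @conj_scalar R k}).
Hypothesis dot_norm : induces_norm dot.
Variables f_ g_ : nat -> H.

(** The [+ 1] keeps the weight positive where [g_ n] vanishes; [2 ^+ n] makes the termwise estimate
    summable. *)
Definition dual_weight n : R := (rnorm (g_ n) + 1) * 2 ^+ n.

Lemma dual_weight_gt0 n : 0 < dual_weight n.
Proof. by rewrite mulr_gt0 ?exprn_gt0// ltr_wpDl ?rnorm_ge0. Qed.

Lemma sum_expr2V_le2 m : \sum_(0 <= i < m) 2 ^- i <= 2 :> R.
Proof.
suff -> : \sum_(0 <= i < m) 2 ^- i = 2 - 2 * 2 ^- m :> R.
  by rewrite gerBl mulr_ge0 ?invr_ge0 ?exprn_ge0.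
elim: m => [|m IH]; first by rewrite big_nil expr0 invr1 mulr1 subrr.
by rewrite big_nat_recr//= IH exprSr invfM; lra.
Qed.

(** The bound holds for every partial sum, term by term against [|f| 2 ^- i], and passes to the
    limit by Cauchy-Schwarz. *)
Lemma dot_mult_op_le (f h : H) : mult_dom dot f_ g_ f ->
  (forall n, dual_weight n * rmod (dot (f_ n) h) <= 1) ->
  rmod (dot (mult_op dot f_ g_ f) h) <= 2 * rnorm f.
Proof.
move=> fD hB; set y := mult_op _ _ _ _; pose s := mult_series dot f_ g_ f.
have sy : s @ \oo --> y by exact: fD.
have sE m : dot (s m) h = \sum_(0 <= i < m) dot f (g_ i) * dot (f_ i) h.
  rewrite /s /mult_series /series /= linear_sumlz.
  by apply: eq_bigr => i _; rewrite -dotZl.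
have term i : rmod (dot f (g_ i) * dot (f_ i) h) <= rnorm f * 2 ^- i.
  rewrite rmodM.
  apply: le_trans (ler_wpM2r (rmod_ge0 _) (cauchy_schwarz dot_norm _ _)) _.
  rewrite -mulrA ler_wpM2l ?rnorm_ge0// -[leRHS]mul1r ler_pdivlMr ?exprn_gt0//.
  apply: le_trans (hB i); rewrite mulrAC ler_wpM2r ?rmod_ge0//.
  by rewrite /dual_weight ler_wpM2r ?exprn_ge0// lerDl.
have s_le m : rmod (dot (s m) h) <= 2 * rnorm f.
  rewrite sE; apply: le_trans (rmod_sum _ _) _.
  apply: le_trans (ler_sum _ (fun i _ => term i)) _.
  by rewrite -mulr_sumr mulrC ler_wpM2r ?rnorm_ge0// sum_expr2V_le2.
apply/ler_addgt0Pl => e e0.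
(* The [+ 1] permits the division even when [h = 0]. *)
have h1 : 0 < rnorm h + 1 by rewrite ltr_wpDl ?rnorm_ge0.
have [N /(_ _ (leqnn N)) sN] := cvg_rnormP sy (divr_gt0 e0 h1).
rewrite -[y](subrK (s N)) dotDl; apply: le_trans (rmodD _ _) _.
rewrite lerD//; apply: le_trans (cauchy_schwarz dot_norm _ _) _.
apply: le_trans (ler_wpM2r (rnorm_ge0 _) (ltW sN)) _.
by rewrite mulrAC ler_pdivrMr// ler_wpM2l ?(ltW e0)// lerDl.
Qed.

End Multipliers.

Theorem proposition3p6 (R : realType) (k : scalar_kind)
    (H : completeNormedModType (scalar_field R k))
    (dot : {dot H for @conj_scalar R k})
    (dot_norm : induces_norm dot)
    (H_infinite_dim : ~ finite_dimensional H)
    (H_separable : separable_space H)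
    (f_ g_ : nat -> H)
    (M_closed : closed_operator (mult_dom dot f_ g_) (mult_op dot f_ g_))
    (M_surj : mult_op dot f_ g_ @` mult_dom dot f_ g_ = [set: H]) :
  forall A : R, 0 < A ->
    exists omega : nat -> R,
      (forall n, 0 < omega n) /\
      lower_semi_frame dot (fun n => of_real k (omega n) *: f_ n) A.
Proof.
move=> A A0; pose w := dual_weight g_.
pose B : set H := [set h | forall n, w n * rmod (dot (f_ n) h) <= 1].
have [|C hC] := @weakly_bounded_bounded _ _ _ _ dot_norm B.
  move=> y; have : [set: H] y by [].
  rewrite -M_surj => -[f fD <-]; exists (2 * rnorm f) => h.
  exact: dot_mult_op_le.
(* [D] is positive and strictly above [C]; this strictness yields the final contradiction. *)
pose D := `|C| + 1; have D0 : 0 < D by rewrite ltr_wpDl.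
have w0 n : 0 < w n by exact: dual_weight_gt0.
clearbody w.
have sA0 : 0 < Num.sqrt A by rewrite sqrtr_gt0.
exists (fun n => w n * D * Num.sqrt A); split => [n|].
  by rewrite !mulr_gt0.
split => // h; rewrite leNgt; apply/negP => S_lt.
(* Each term of the nonnegative frame sum is at most the whole sum, hence below [A |h|^2]; cancel
   [A] and take square roots. *)
have term n : w n * D * rmod (dot (f_ n) h) < rnorm h.
  have : ((rmod (dot h (of_real k (w n * D * Num.sqrt A) *: f_ n)) ^+ 2)%:E <
      (A * rnorm h ^+ 2)%:E)%E.
    apply: le_lt_trans S_lt.
    apply: le_trans (nneseries_lim_ge n.+1 _); last first.
      by move=> i _ _; rewrite lee_fin sqr_ge0.
    rewrite big_nat_recr//= leeDr// sume_ge0// => i _.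
    by rewrite lee_fin sqr_ge0.
  rewrite rmod_dotC dotZl rmodM rmod_of_real ger0_norm ?mulr_ge0 ?ltW//.
  rewrite mulrAC exprMn sqr_sqrtr ?(ltW A0)// lte_fin mulrC ltr_pM2l//.
  by rewrite ltr_pXn2r// nnegrE ?rnorm_ge0// !mulr_ge0 ?rmod_ge0 ?ltW.
(* The strict inequality in [term], already at index 0, excludes [h = 0]. *)
have h0 : 0 < rnorm h.
  by apply: le_lt_trans (term 0%N); rewrite !mulr_ge0 ?rmod_ge0 ?ltW.
(* By [term], the multiple of [h] of norm [D] lies in [B], so [D <= C], which is absurd. *)
have : rnorm (of_real k (D / rnorm h) *: h) <= C.
  apply: hC => n; rewrite rmod_dotC dotZl rmodM rmod_of_real rmod_dotC.
  rewrite ger0_norm; last by rewrite divr_ge0 ?ltW.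
  by rewrite mulrA [w n * _]mulrA mulrAC ler_pdivrMr// mul1r ltW.
rewrite rnormZ rmod_of_real ger0_norm; last by rewrite divr_ge0 ?ltW.
rewrite divfK ?gt_eqF//.
by rewrite /D => DC; have := ler_norm C; lra.
Qed.
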